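(* Let $M$ be a nonempty set, let $F:M\times M\to\mathbb{R}\cup\{-\infty,\infty\}$ be triangular and reflexive, and let $\mu(x)=\sup\{-F(x,y):y\in M\}$, $x\in M$. Let $d$ be an almost metric on $M$, let $b:\mathbb{R}_+\to\mathbb{R}_+$ be a normal function with $B(t)=\int_0^t b(\tau)\,d\tau$, let $\Gamma:M\to\mathbb{R}_+$ be almost $d$-nonexpansive, and let $e=e(B,\Gamma;d)$ be the Zhong metric $e(x,y)=B(\Gamma(x)+d(x,y))-B(\Gamma(x))$, $x,y\in M$. Suppose that $\mu$ is proper, i.e. $\mathrm{Dom}(\mu)=\{x\in M:\mu(x)<\infty\}\neq\emptyset$, and that $(d,F)$ is semi descending complete. Then for each $u\in\mathrm{Dom}(\mu)$ there exists $v=v(u)\in M$ such that (iii) $b(\Gamma(u)+d(u,v))\,d(u,v)\le e(u,v)\le -F(u,v)\le\mu(u)$; (iv) $b(\Gamma(v))\,d(v,x)\ge e(v,x)>-F(v,x)$ for all $x\in M\setminus\{v\}$. Hence, in particular, $v$ is an equilibrium point for $G(x,y)=F(x,y)+b(\Gamma(x))\,d(x,y)$, $x,y\in M$, i.e. $G(v,x)\ge 0$ for all $x\in M$. Moreover, $u\in\mathrm{Dom}(\mu)$ whenever $\mu(u)\le B(\Gamma(u)+\rho)-B(\Gamma(u))$ for some $\rho>0$; and in this case (iii) implies $$d(u,v)\le\rho,\quad\text{hence }\Gamma(v)\le\Gamma(u)+\rho,$$ and (v) $b(\Gamma(u)+\rho)\,d(u,v)\le -F(u,v)$ (hence $F(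u,v)\le0$).
   Context: $\mathbb{R}_+=[0,\infty)$. A function $F:M\times M\to\mathbb{R}\cup\{-\infty,\infty\}$ is triangular if $F(x,z)\le F(x,y)+F(y,z)$ whenever the right-hand side exists, and reflexive if $F(x,x)=0$ for all $x\in M$. An almost metric on $M$ is a map $d:M\times M\to\mathbb{R}_+$ (not necessarily symmetric) with $d(x,z)\le d(x,y)+d(y,z)$ for all $x,y,z$, and $d(x,y)=0\iff x=y$. A sequence $(x_n)$ is $d$-Cauchy if for each $\delta>0$ there is $n(\delta)$ such that $n(\delta)\le p\le q$ implies $d(x_p,x_q)\le\delta$; $x_n\stackrel{d}{\to}x$ iff $d(x_n,x)\to0$. For $\varphi:M\to\mathbb{R}\cup\{\infty\}$ put $\mathrm{Dom}(\varphi)=\{x\in M:\varphi(x)<\infty\}$; $\varphi$ is inf-proper if $\mathrm{Dom}(\varphi)\ne\emptyset$ and $\inf\varphi(M)>-\infty$. For inf-proper $\varphi$, the pair $(d,\varphi)$ is descending complete if for each $d$-Cauchy sequence $(x_n)$ in $\mathrm{Dom}(\varphi)$ with $(\varphi(x_n))$ descending (nonincreasing) there exists $x\in M$ with $x_n\stackrel{d}{\to}x$ and $\lim_n\varphi(x_n)\ge\varphi(x)$. For $u\in\mathrm{Dom}(\mu)$ put $F_u(\cdot)=F(u,\cdot)$; since $F_u(u)=0$ and $\inf F_u(M)=-\mu(u)>-\infty$, $F_u$ is an inf-proper function $M\to\mathbb{R}\cup\{\infty\}$. The pair $(d,F)$ is semi descending complete if $(d,F_u)$ is descending complete for each $u\in\mathrm{Dom}(\mu)$.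 A function $b:\mathbb{R}_+\to\mathbb{R}_+$ is normal if it is decreasing (in the non-strict sense), $b(\mathbb{R}_+)\subseteq(0,\infty)$, and $B(\infty)=\infty$, where $B(t)=\int_0^t b(\tau)\,d\tau$ for $t\ge0$ (i.e. $B(t)\to\infty$ as $t\to\infty$). A function $\Gamma:M\to\mathbb{R}_+$ is almost $d$-nonexpansive if $\Gamma(x)-\Gamma(y)+d(x,y)\ge0$ for all $x,y\in M$. *)

(* Defs.v *)
From HB Require Import structures.
From mathcomp Require Import all_boot all_order all_algebra.
From mathcomp Require Import all_classical all_reals all_analysis.

Set Implicit Arguments.
Unset Strict Implicit.
Unset Printing Implicit Defensive.

Import Order.TTheory GRing.Theory Num.Theory.
Import numFieldNormedType.Exports.

Local Open Scope classical_set_scope.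
Local Open Scope ring_scope.

(* Maps into R_+ are R-valued maps with an explicit nonnegativity clause. *)

Section ExtendedRealMaps.
Context {R : realType} {M : Type}.

(* [a +? b] excludes exactly oo + (-oo) and (-oo) + oo, i.e. it says that the
   sum a + b exists. *)
Definition triangular (F : M -> M -> \bar R) : Prop :=
  forall x y z, (F x y +? F y z)%E -> (F x z <= F x y + F y z)%E.

Definition reflexive_ereal (F : M -> M -> \bar R) : Prop :=
  forall x, F x x = 0%E.

Definition mu_of (F : M -> M -> \bar R) (x : M) : \bar R :=
  ereal_sup [set (- F x y)%E | y in [set: M]].

Definition Dom (phi : M -> \bar R) : set M := [set x | (phi x < +oo)%E].

Definition proper_ereal (phi : M -> \bar R) : Prop := Dom phi !=set0.

Definition inf_proper (phi : M -> \bar R) : Prop :=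
  proper_ereal phi /\ (-oo < ereal_inf (range phi))%E.

Definition equilibrium_point (G : M -> M -> \bar R) (v : M) : Prop :=
  forall x, (0 <= G v x)%E.

Lemma inf_proper_slice (F : M -> M -> \bar R) (u : M) :
  reflexive_ereal F -> Dom (mu_of F) u -> inf_proper (F u).
Proof.
move=> F0 uD; split; first by exists u; rewrite /Dom/= F0 ltry.
rewrite /ereal_inf image_comp lteNr /=.
by move: uD; rewrite /Dom /mu_of.
Qed.

End ExtendedRealMaps.

Section AlmostMetrics.
Context {R : realType} {M : Type}.
Implicit Types (d : M -> M -> R) (xs : nat -> M).

Definition almost_metric d : Prop :=
  [/\ forall x y, 0 <= d x y,
      forall x y z, d x z <= d x y + d y z
    & forall x y, d x y = 0 <-> x = y].

Definition d_Cauchy d xs : Prop :=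
  forall delta : R, 0 < delta ->
  exists N : nat, forall p q : nat,
    (N <= p)%N -> (p <= q)%N -> d (xs p) (xs q) <= delta.

(* The order of the arguments matters, since d need not be symmetric. *)
Definition d_converges d xs (x : M) : Prop :=
  d (xs n) x @[n --> \oo] --> (0 : R).

(* Only meant for inf-proper_ereal phi; the limit below exists in \bar R because the
   sequence is nonincreasing. *)
Definition descending_complete d (phi : M -> \bar R) : Prop :=
  forall xs, (forall n, Dom phi (xs n)) -> d_Cauchy d xs ->
  nonincreasing_seq (fun n => phi (xs n)) ->
  exists2 x, d_converges d xs x & (phi x <= limn (fun n => phi (xs n)))%E.

(* The slices F u in question are inf-proper_ereal when F is reflexive, by
   inf_proper_slice. *)
Definition semi_descending_complete d (F : M -> M -> \bar R) : Prop :=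
  forall u, Dom (mu_of F) u -> descending_complete d (F u).

Definition almost_nonexpansive d (Gamma : M -> R) : Prop :=
  forall x y, 0 <= Gamma x - Gamma y + d x y.

End AlmostMetrics.

Section ZhongMetric.
Context {R : realType} {M : Type}.

(* For b nonincreasing on R_+ the integrand is bounded and measurable on
   [0, t], so this Lebesgue integral is also the Riemann one. *)
Definition primitive0 (b : R -> R) (t : R) : R :=
  (\int[lebesgue_measure]_(tau in `[0%R, t]) b tau)%R.

(* The values of b on the negative reals are irrelevant.  Positivity subsumes
   the requirement that b maps R_+ to R_+. *)
Definition normal_rate (b : R -> R) : Prop :=
  [/\ forall s t : R, 0 <= s -> s <= t -> b t <= b s,
      forall t : R, 0 <= t -> 0 < b t
    & primitive0 b t @[t --> +oo] --> +oo].

Definition zhong_metric (B : R -> R) (Gamma : M -> R) (d : M -> M -> R)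
    (x y : M) : R :=
  B (Gamma x + d x y) - B (Gamma x).

End ZhongMetric.

(* Main.v *)
Require Import Defs.
From HB Require Import structures.
From mathcomp Require Import all_boot all_order all_algebra.
From mathcomp Require Import all_classical all_reals all_analysis.
From mathcomp Require Import measurable_realfun.
From mathcomp Require Import lra.

Set Implicit Arguments.
Unset Strict Implicit.
Unset Printing Implicit Defensive.

Import Order.TTheory GRing.Theory Num.Theory.
Import numFieldNormedType.Exports.

Local Open Scope classical_set_scope.
Local Open Scope ring_scope.

(** Fix [u] with [mu u] finite and put [phi := F u].  The triangle inequality
    for [F] says [phi x <= phi v + F v x], hence [- F v x <= phi v - phi x].  So
    an Ekeland-type statement about the one function [phi] and the
    quasi-metric [e] is enough: a point [v] with [e u v <= phi u - phi v],
    where [phi u = 0] and [phi v = F u v], and with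
    [phi v - phi x < e v x] for every [x <> v].  This is
    [zhong_variational_principle].

    Its proof follows Ekeland's.  The relation [e x y + phi y <= phi x] is a
    preorder because [e] satisfies the triangle inequality.  That inequality
    is where the hypotheses on [b] and [Gamma] meet: [B] is increasing and
    concave since [b] is positive and nonincreasing, and
    [Gamma y <= Gamma x + d x y].  A chain that starts at [u] and whose
    [n+1]-st term minimizes [phi] up to [1/(n+1)] among the points below the
    [n]-th one has oscillations of [phi], hence [e]-distances, that tend to
    zero; a point below the limit of such a chain must be the limit itself.

    Completeness is assumed for [d] and not for [e], so the chain has to be
    shown [d]-Cauchy.  Since [B] is unbounded, a bound on the [e]-distances
    along the chain bounds [Gamma x + d x y] by some [K]
    ([zhong_bounded]), and on that range [b K * d x y <= e x y].

    The bounds of [e] by multiples of [d] come from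
    [b (s + h) * h <= B (s + h) - B s <= b s * h].  The estimate
    [d u v <= rho] holds because [B] is strictly increasing on [R_+]: the
    bound on [mu u] gives [B (Gamma u + d u v) <= B (Gamma u + rho)]. *)

(** * The primitive of a normal rate function *)

Section Primitive.
Context {R : realType}.
Variables (b : R -> R).
Hypothesis b_normal : normal_rate b.
Let B := primitive0 b.

(** Monotonicity is only known on [R_+], while the measurability criterion
    asks for it on the whole line; [b \o Num.max 0] is monotone everywhere and
    agrees with [b] on the interval. *)
Lemma integrable_normal_rate (s t : R) : 0 <= s ->
  lebesgue_measure.-integrable `[s, t] (EFin \o b).
Proof.
move=> s0; have [b_ni b_gt0 _] := b_normal.
apply: measurable_bounded_integrable => //.
- by rewrite /= lebesgue_measure_itv/=; case: ifPn => // _; rewrite ltry.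
- apply: (@eq_measurable_fun _ _ _ _ _ (b \o Num.max 0)) => [x|].
    rewrite inE /= in_itv/= => /andP[sx _].
    by rewrite (max_idPr (le_trans s0 sx)).
  apply: nonincreasing_measurable => // x y xy /=.
  by apply: b_ni; [rewrite le_max lexx | exact: le_max2].
- exists (b 0); split; first exact: num_real.
  move=> K bK x /=; rewrite in_itv/= => /andP[sx _].
  have x0 := le_trans s0 sx.
  by rewrite ger0_norm ?(ltW (b_gt0 _ x0))// (le_trans _ (ltW bK))// b_ni.
Qed.

Lemma primitive0B (s t : R) : 0 <= s -> s <= t ->
  B t - B s = (\int[lebesgue_measure]_(x in `[s, t]) b x)%R.
Proof.
move=> s0 st; rewrite /B /primitive0 Rintegral_itvB ?bnd_simp//; last first.
  exact: integrable_normal_rate.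
rewrite Rintegral_itv_obnd_cbnd//.
apply: integrableS (integrable_normal_rate t s0) => //.
exact: subset_itv_oc_cc.
Qed.

Lemma Rintegral_itv_cst (s t k : R) : s <= t ->
  (\int[lebesgue_measure]_(x in `[s, t]) k)%R = k * (t - s).
Proof.
move=> st; rewrite Rintegral_cst//; congr (_ * _).
rewrite /= lebesgue_measure_itv/= lte_fin; case: ltgtP st => // -> _.
by rewrite subrr.
Qed.

Lemma integrable_itv_cst (s t k : R) :
  lebesgue_measure.-integrable `[s, t] (EFin \o cst k).
Proof.
apply: measurable_bounded_integrable => //.
  by rewrite /= lebesgue_measure_itv/=; case: ifPn => // _; rewrite ltry.
exact: bounded_cst.
Qed.

Lemma primitive0D_le (s h : R) : 0 <= s -> 0 <= h ->
  B (s + h) - B s <= b s * h.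
Proof.
move=> s0 h0; have [b_ni _ _] := b_normal.
have sh : s <= s + h by rewrite lerDl.
rewrite -[h in b s * h](addKr s) [- s + _]addrC primitive0B//.
rewrite -Rintegral_itv_cst//; apply: le_Rintegral => //.
- exact: integrable_normal_rate.
- exact: integrable_itv_cst.
- by move=> x /=; rewrite in_itv/= => /andP[sx _]; exact: b_ni.
Qed.

Lemma primitive0D_ge (s h : R) : 0 <= s -> 0 <= h ->
  b (s + h) * h <= B (s + h) - B s.
Proof.
move=> s0 h0; have [b_ni _ _] := b_normal.
have sh : s <= s + h by rewrite lerDl.
rewrite -[h in _ * h](addKr s) [- s + _]addrC primitive0B//.
rewrite -Rintegral_itv_cst//; apply: le_Rintegral => //.
- exact: integrable_itv_cst.
- exact: integrable_normal_rate.
- move=> x /=; rewrite in_itv/= => /andP[sx xt].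
  by apply: b_ni => //; exact: le_trans sx.
Qed.

Lemma primitive0_lt (s t : R) : 0 <= s -> s < t -> B s < B t.
Proof.
move=> s0 st; have [_ b_gt0 _] := b_normal.
have h0 : 0 < t - s by rewrite subr_gt0.
have := primitive0D_ge s0 (ltW h0); rewrite addrC subrK => le.
rewrite -subr_gt0 (lt_le_trans _ le)// mulr_gt0// b_gt0//.
by rewrite (le_trans s0)// ltW.
Qed.

Lemma primitive0_mono (s t : R) : 0 <= s -> 0 <= t -> (B s <= B t) = (s <= t).
Proof.
move=> s0 t0; have [st|ts] := leP s t; last first.
  by apply/negbTE; rewrite -ltNge primitive0_lt.
move: st; rewrite le_eqVlt => /predU1P[->|]; first by rewrite lexx.
by move=> /(primitive0_lt s0)/ltW.
Qed.

(** The increments over [[s, s + h]] and [[t, t + h]] differ only by what these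
    intervals do not share, and there any value of [b] taken in the first is at
    least any value taken in the second. *)
Lemma primitive0_concave (s t h : R) : 0 <= s -> s <= t -> 0 <= h ->
  B (t + h) - B t <= B (s + h) - B s.
Proof.
move=> s0 st h0; have [b_ni _ _] := b_normal.
have t0 := le_trans s0 st.
have [tsh|/ltW sht] := leP t (s + h).
  (* [s, t] and [s + h, t + h] both have length t - s and are what remains
     once the common part [t, s + h] has been cancelled. *)
  have ts0 : 0 <= t - s by rewrite subr_ge0.
  have := primitive0D_ge s0 ts0.
  have := primitive0D_le (addr_ge0 s0 h0) ts0.
  have -> : s + h + (t - s) = t + h by lra.
  rewrite [s + _]addrC subrK.
  have : b (s + h) * (t - s) <= b t * (t - s) by rewrite ler_wpM2r// b_ni.
  lra.
have : b t * h <= b (s + h) * h by rewrite ler_wpM2r// b_ni// addr_ge0.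
have := primitive0D_ge s0 h0; have := primitive0D_le t0 h0.
lra.
Qed.

Lemma primitive0_unbounded (r : R) : exists2 K, 0 <= K & r < B K.
Proof.
have [_ _ /cvgryPgt/(_ r)] := b_normal.
move=> [A [_ Ar]]; exists (Num.max 0 (A + 1)); first by rewrite le_max lexx.
by apply: Ar; rewrite lt_max ltrDl ltr01 orbT.
Qed.

End Primitive.

(** * The Zhong metric *)

Section Zhong.
Context {R : realType} {M : Type}.
Variables (d : M -> M -> R) (b : R -> R) (Gamma : M -> R).
Hypotheses (d_am : almost_metric d) (b_normal : normal_rate b).
Hypotheses (Gamma_ge0 : forall x, 0 <= Gamma x).
Hypothesis (Gamma_ane : almost_nonexpansive d Gamma).
Let B := primitive0 b.
Let e := zhong_metric B Gamma d.

Let d_ge0 x y : 0 <= d x y. Proof. by case: d_am. Qed.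

Let dxx x : d x x = 0. Proof. by case: d_am => _ _ /(_ x x)[_ ->]. Qed.

Let Gd_ge0 x y : 0 <= Gamma x + d x y. Proof. exact: addr_ge0. Qed.

Let Gamma_le x y : Gamma y <= Gamma x + d x y.
Proof. by have := Gamma_ane x y; lra. Qed.

Lemma zhong_xx x : e x x = 0.
Proof. by rewrite /e /zhong_metric dxx addr0 subrr. Qed.

Lemma zhong_le x y : e x y <= b (Gamma x) * d x y.
Proof. exact: (primitive0D_le b_normal (Gamma_ge0 x) (d_ge0 x y)). Qed.

Lemma zhong_ge x y : b (Gamma x + d x y) * d x y <= e x y.
Proof. exact: (primitive0D_ge b_normal (Gamma_ge0 x) (d_ge0 x y)). Qed.

Lemma zhong_ge_bnd K x y : Gamma x + d x y <= K -> b K * d x y <= e x y.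
Proof.
have [b_ni _ _] := b_normal => GdK; apply: le_trans (zhong_ge x y).
by rewrite ler_wpM2r// b_ni.
Qed.

Lemma zhong_ge0 x y : 0 <= e x y.
Proof.
have [_ b_gt0 _] := b_normal; apply: le_trans (zhong_ge x y).
by rewrite mulr_ge0// ltW// b_gt0.
Qed.

Lemma zhong_le0_eq x y : e x y <= 0 -> x = y.
Proof.
have [_ b_gt0 _] := b_normal; have [_ _ d0] := d_am => exy0.
apply/d0/eqP; rewrite eq_le d_ge0 andbT.
by have := le_trans (zhong_ge x y) exy0; rewrite pmulr_rle0// b_gt0.
Qed.

(** By concavity, the increment of [B] over a step of length [d y z] is
    smaller when it starts from [Gamma x + d x y] than from [Gamma y]. *)
Lemma zhong_triangle x y z : e x z <= e x y + e y z.
Proof.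
have [_ dtri _] := d_am; rewrite /e /zhong_metric -/B.
have : B (Gamma x + d x z) <= B (Gamma x + d x y + d y z).
  by rewrite primitive0_mono// ?addr_ge0// -addrA lerD2l.
have := primitive0_concave b_normal (Gamma_ge0 y) (Gamma_le x y) (d_ge0 y z).
rewrite -/B; move: (B _) (B _) (B _) (B _) (B _) => B1 B2 B3 B4 B5; lra.
Qed.

(** Coercivity: [B] is unbounded, so small increments of [B] keep its argument
    bounded.  Two steps are needed, since the increment from [Gamma x] is only
    controlled once [B (Gamma x)] is, which the distance from the fixed point
    [u] provides. *)
Lemma zhong_bounded u r : exists K,
  0 <= K /\ forall x y, e u x <= r -> e x y <= r -> Gamma x + d x y <= K.
Proof.
have [K K0 rK] := primitive0_unbounded b_normal (B (Gamma u) + r + r).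
exists K; split=> // x y.
have : B (Gamma x) <= B (Gamma u + d u x) by rewrite primitive0_mono.
rewrite -[_ + _ <= K](primitive0_mono b_normal)//.
rewrite /e /zhong_metric -/B; move: rK; rewrite -/B.
move: (B _) (B _) (B _) (B _) (B _) => B1 B2 B3 B4 B5; lra.
Qed.

End Zhong.

(** * Approximate minimizers *)

Lemma near_minimizer {R : realType} {M : Type} (phi : M -> \bar R) (A : set M)
    (m eps : R) : (forall x, m%:E <= phi x)%E -> A !=set0 -> 0 < eps ->
  exists2 y, A y & forall z, A z -> (phi y <= phi z + eps%:E)%E.
Proof.
move=> m_phi [a Aa] eps0.
have Iphi z : A z -> (ereal_inf (phi @` A) <= phi z)%E.
  by move=> Az; apply: ereal_inf_lbound; exists z.
have mI : (m%:E <= ereal_inf (phi @` A))%E.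
  by apply: le_ereal_inf_tmp => _ [z _ <-].
have [Ioo|Ioo] := eqVneq (ereal_inf (phi @` A)) +oo%E.
  exists a => // z /Iphi; rewrite Ioo leye_eq => /eqP ->.
  by rewrite addye// leey.
have I_fin : ereal_inf (phi @` A) \is a fin_num.
  by rewrite fin_numE Ioo andbT -ltNye (lt_le_trans _ mI)// ltNyr.
have [_ [y Ay <-] /ltW yI] := lb_ereal_inf_adherent eps0 I_fin.
exists y => // z /Iphi Iz; apply: (le_trans yI).
by rewrite leeD2r.
Qed.

(** * The variational principle for the Zhong metric *)

Section ZhongPrinciple.
Context {R : realType} {M : Type}.
Variables (d : M -> M -> R) (b : R -> R) (Gamma : M -> R).
Hypotheses (d_am : almost_metric d) (b_normal : normal_rate b).
Hypotheses (Gamma_ge0 : forall x, 0 <= Gamma x).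
Hypothesis (Gamma_ane : almost_nonexpansive d Gamma).
Let e := zhong_metric (primitive0 b) Gamma d.

Variable phi : M -> \bar R.

(** This is [e x y <= phi x - phi y], written without a difference so that it
    also makes sense where [phi] is infinite. *)
Definition below (x y : M) : Prop := ((e x y)%:E + phi y <= phi x)%E.

Lemma below_refl x : below x x.
Proof. by rewrite /below /e zhong_xx// add0e. Qed.

Lemma below_trans x y z : below x y -> below y z -> below x z.
Proof.
move=> xy yz; apply: le_trans xy; apply: le_trans (leeD2l _ yz).
by rewrite addeA -EFinD leeD2r// lee_fin zhong_triangle.
Qed.

Lemma below_le x y : below x y -> (phi y <= phi x)%E.
Proof.
by move=> /(le_trans _); apply; rewrite leeDr// lee_fin zhong_ge0.
Qed.

Lemma below_chain (xs : nat -> M) : (forall n, below (xs n) (xs n.+1)) ->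
  forall p q, (p <= q)%N -> below (xs p) (xs q).
Proof.
move=> step p; elim=> [|q IHq].
  by rewrite leqn0 => /eqP ->; exact: below_refl.
rewrite leq_eqVlt => /predU1P[->|]; first exact: below_refl.
by rewrite ltnS => /IHq /below_trans; apply.
Qed.

Variable m : R.
Hypothesis m_phi : forall x, (m%:E <= phi x)%E.

Lemma below_zhong_le x y (r : R) : below x y -> (phi y < +oo)%E ->
  (phi x <= phi y + r%:E)%E -> e x y <= r.
Proof.
move=> /le_trans exy yoo /exy; rewrite addeC.
have yfin : phi y \is a fin_num.
  by rewrite fin_numElt yoo andbT (lt_le_trans _ (m_phi y))// ltNyr.
by rewrite leeD2lE// lee_fin.
Qed.

(** Along a chain, [phi] is nonincreasing and bounded below, so its oscillation
    and thus the [e]-distances are eventually small.  These distances are also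
    globally at most [phi (xs 0) - m]; by coercivity [d] is then
    dominated by a multiple of [e] along the whole chain. *)
Lemma below_chain_Cauchy (xs : nat -> M) : (phi (xs 0%N) < +oo)%E ->
  (forall n, below (xs n) (xs n.+1)) -> d_Cauchy d xs.
Proof.
have [_ b_gt0 _] := b_normal => x0oo /below_chain chain.
have xnoo n : (phi (xs n) < +oo)%E.
  exact: le_lt_trans (below_le (chain _ _ (leq0n n))) x0oo.
have [K [K0 bndK]] := zhong_bounded d_am b_normal Gamma_ge0 Gamma_ane
  (xs 0%N) (fine (phi (xs 0%N)) - m).
have x0E : (fine (phi (xs 0%N)))%:E = phi (xs 0%N).
  by rewrite fineK// fin_numElt x0oo andbT (lt_le_trans _ (m_phi _))// ltNyr.
have le_osc p q : (p <= q)%N -> e (xs p) (xs q) <= fine (phi (xs 0%N)) - m.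
  move=> /chain pq; apply: (below_zhong_le pq) => //.
  apply: (le_trans (below_le (chain _ _ (leq0n p)))).
  by rewrite -x0E addeC EFinB -addeA leeDl// addeC sube_ge0.
move=> delta delta0.
(* An approximate minimizer of [phi] over the chain bounds every later
   oscillation. *)
have [_ [N _ <-] Nmin] := near_minimizer m_phi
  (ex_intro _ _ (imageT xs 0%N)) (mulr_gt0 (b_gt0 _ K0) delta0).
exists N => p q Np pq; rewrite -(ler_pM2l (b_gt0 _ K0)).
apply: le_trans (_ : e (xs p) (xs q) <= _).
  by apply: zhong_ge_bnd => //; apply: bndK; exact: le_osc.
apply: (below_zhong_le (chain _ _ pq)) => //.
apply: (le_trans (below_le (chain _ _ Np))); apply: Nmin; exact: imageT.
Qed.

(** [e (xs n) x <= e (xs n) (xs k) + e (xs k) x] and the last term tends to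
    zero with [d (xs k) x], as [e <= b 0 * d]; passing to the limit turns
    [below (xs n) (xs k)] into [below (xs n) x]. *)
Lemma below_chain_limit (xs : nat -> M) x : d_converges d xs x ->
  (forall n, below (xs n) (xs n.+1)) ->
  (phi x <= limn (phi \o xs))%E -> forall n, below (xs n) x.
Proof.
have [b_ni b_gt0 _] := b_normal => xs_x /below_chain chain x_lim n.
have lim_le k : (limn (phi \o xs) <= phi (xs k))%E.
  rewrite (cvg_lim _ (@ereal_nonincreasing_cvgn _ (phi \o xs) _))//.
    by apply: ereal_inf_lbound; exists k.
  by move=> p q /chain/below_le.
apply/lee_addgt0Pr => eps eps0.
have b00 := b_gt0 _ (lexx 0).
have : \forall k \near \oo, d (xs k) x < eps / b 0.
  by move/cvgr_lt : xs_x => /(_ (eps / b 0)); apply; rewrite divr_gt0.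
move=> [k0 _ /(_ (maxn k0 n) (leq_maxl _ _))]; set k := maxn _ _ => /= dk.
have ek : e (xs k) x <= eps.
  apply: (le_trans (zhong_le d_am b_normal Gamma_ge0 _ _)).
  apply: le_trans (_ : b 0 * d (xs k) x <= _).
    by rewrite ler_wpM2r ?b_ni//; case: d_am.
  by rewrite mulrC -ler_pdivlMr// ltW.
have nk := chain _ _ (leq_maxr k0 n); rewrite -/k in nk.
apply: le_trans (leeD2r _ nk).
rewrite addeAC; apply: leeD; last exact: le_trans x_lim (lim_le k).
rewrite -EFinD lee_fin.
have := zhong_triangle d_am b_normal Gamma_ge0 Gamma_ane (xs n) (xs k) x.
by move=> /le_trans; apply; rewrite lerD2l.
Qed.

End ZhongPrinciple.

(** If [x] is below the limit [v] of the chain [xs], it is below every [xs n],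
    so the near-minimality of [xs n.+1] forces [phi v <= phi x]; together with
    [e v x + phi x <= phi v] this makes [e v x] vanish. *)
Lemma zhong_variational_principle {R : realType} {M : Type}
    (d : M -> M -> R) (b : R -> R) (Gamma : M -> R) (phi : M -> \bar R) (u : M) :
  almost_metric d -> normal_rate b ->
  (forall x, 0 <= Gamma x) -> almost_nonexpansive d Gamma ->
  inf_proper phi -> descending_complete d phi -> Dom phi u ->
  let e := zhong_metric (primitive0 b) Gamma d in
  exists v, ((e u v)%:E + phi v <= phi u)%E /\
    forall x, x <> v -> (phi v < (e v x)%:E + phi x)%E.
Proof.
move=> d_am b_normal G0 G_ane [[a ax] inf_phi] dc uoo e.
pose ble := below d b Gamma phi.
have [m m_phi] : exists m : R, forall x, (m%:E <= phi x)%E.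
  exists (fine (ereal_inf (range phi))) => x; rewrite fineK.
    by apply: ereal_inf_lbound; exists x.
  rewrite fin_numElt inf_phi (le_lt_trans _ ax)//.
  by apply: ereal_inf_lbound; exists a.
(* The tolerance depends on [n] alone, so a choice function on pairs
   [(n, x)] can be iterated. *)
have next n x : exists y, ble x y /\
    forall z, ble x z -> (phi y <= phi z + n.+1%:R^-1%:E)%E.
  have [||y xy ymin] := @near_minimizer _ _ phi (ble x) m n.+1%:R^-1 m_phi.
  - by exists x; exact: below_refl.
  - by rewrite invr_gt0 ltr0n.
  - by exists y.
have [f f_next] := choice (fun nx : nat * M => next nx.1 nx.2).
pose xs := fix xs n := if n is k.+1 then f (k, xs k) else u.
have xs_step n : ble (xs n) (xs n.+1) by case: (f_next (n, xs n)).
have xs_min n z : ble (xs n) z -> (phi (xs n.+1) <= phi z + n.+1%:R^-1%:E)%E.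
  by case: (f_next (n, xs n)) => _; apply.
have chain := below_chain d_am b_normal G0 G_ane xs_step.
have [n|||v xs_v v_lim] := dc xs.
- exact: le_lt_trans (below_le d_am b_normal G0 (chain _ _ (leq0n n))) uoo.
- exact: (below_chain_Cauchy d_am b_normal G0 G_ane m_phi uoo xs_step).
- by move=> p q /chain/(below_le d_am b_normal G0).
have xsv := below_chain_limit d_am b_normal G0 G_ane xs_v xs_step v_lim.
exists v; split; first exact: (xsv 0%N).
move=> x xv; rewrite ltNge; apply/negP => vx; apply: xv.
have phi_vx : (phi v <= phi x)%E.
  apply/lee_addgt0Pr => eps eps0.
  have [n n_eps] : exists n, n.+1%:R^-1 < eps.
    have [n _ /(_ n (leqnn n))] := near_infty_natSinv_lt (PosNum eps0).
    by exists n.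
  apply: (le_trans (below_le d_am b_normal G0 (xsv n.+1))).
  apply: (le_trans (xs_min n x _)); last by rewrite leeD2l// lee_fin ltW.
  exact: (below_trans d_am b_normal G0 G_ane (xsv n)).
symmetry; apply: (zhong_le0_eq d_am b_normal G0).
apply: (below_zhong_le m_phi vx); last by rewrite adde0.
apply: (le_lt_trans (below_le d_am b_normal G0 vx)).
exact: (le_lt_trans (below_le d_am b_normal G0 (xsv 0%N)) uoo).
Qed.

(** * Equilibrium points of triangular functions *)

Theorem theorem7 (R : realType) (M : Type) (M_nonempty : [set: M] !=set0)
    (F : M -> M -> \bar R) (F_tri : triangular F) (F_refl : reflexive_ereal F)
    (mu : M -> \bar R) (muE : mu = mu_of F)
    (d : M -> M -> R) (d_am : almost_metric d)
    (b : R -> R) (b_normal : normal_rate b)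
    (B : R -> R) (BE : B = primitive0 b)
    (Gamma : M -> R) (Gamma_ge0 : forall x, 0 <= Gamma x)
    (Gamma_ane : almost_nonexpansive d Gamma)
    (e : M -> M -> R) (eE : e = zhong_metric B Gamma d)
    (mu_proper : proper_ereal mu) (dF_sdc : semi_descending_complete d F) :
  (forall u, Dom mu u ->
     exists v : M,
       [/\ [/\ b (Gamma u + d u v) * d u v <= e u v,
               ((e u v)%:E <= - F u v)%E
             & (- F u v <= mu u)%E],
           (forall x, x <> v ->
              e v x <= b (Gamma v) * d v x /\ (- F v x < (e v x)%:E)%E)
         & equilibrium_point
             (fun x y => (F x y + (b (Gamma x) * d x y)%:E)%E) v])
  /\
  (forall (u : M) (rho : R), 0 < rho ->
     (mu u <= (B (Gamma u + rho) - B (Gamma u))%:E)%E ->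
     Dom mu u /\
     forall v : M,
       [/\ b (Gamma u + d u v) * d u v <= e u v,
           ((e u v)%:E <= - F u v)%E
         & (- F u v <= mu u)%E] ->
       [/\ d u v <= rho,
           Gamma v <= Gamma u + rho,
           ((b (Gamma u + rho) * d u v)%:E <= - F u v)%E
         & (F u v <= 0)%E]).
Proof.
have slice_gtNy u x : Dom mu u -> (-oo < F u x)%E.
  rewrite muE => uD; have : (- F u x < +oo)%E.
    by apply: le_lt_trans uD; apply: ereal_sup_ubound; exists x.
  by case: (F u x) => // r; rewrite ltNyr.
have d_ge0 x y : 0 <= d x y by case: d_am.
have Gd_ge0 x y : 0 <= Gamma x + d x y by exact: addr_ge0.
have [b_ni b_gt0 _] := b_normal.
split=> [u uD | u rho rho0 mu_rho].
- have uD' : Dom (mu_of F) u by rewrite -muE.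
  have phi_u : Dom (F u) u by rewrite /Dom/= F_refl ltry.
  have [v [uv vmin]] := zhong_variational_principle d_am b_normal Gamma_ge0
    Gamma_ane (inf_proper_slice F_refl uD') (dF_sdc u uD') phi_u.
  move: uv vmin; rewrite -BE -eE F_refl => uv vmin.
  have [r Fuv] : exists r, F u v = r%:E.
    case: (F u v) (slice_gtNy u v uD) uv => // r _ _.
    by exists r.
  (* [F v x] may be infinite, but [F u v] is not, so that
     [F u x <= F u v + F v x] holds for all [x]. *)
  have v_strict x : x <> v -> (- F v x < (e v x)%:E)%E.
    move=> /vmin vx; have : (F u x <= F u v + F v x)%E.
      by apply: F_tri; rewrite Fuv fin_num_adde_defr.
    move=> /(leeD2l (e v x)%:E) /(lt_le_trans vx).
    rewrite Fuv; case: (F v x) => [s||] //=.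
      by rewrite -!EFinD !lte_fin; lra.
    by rewrite ltNyr.
  exists v; split.
  + split; first by rewrite eE BE; exact: zhong_ge.
      by move: uv; rewrite Fuv -EFinD !lee_fin; lra.
    by rewrite muE; apply: ereal_sup_ubound; exists v.
  + move=> x xv; split; last exact: v_strict.
    by rewrite eE BE; exact: zhong_le.
  + move=> x; have [->|xv] := pselect (x = v).
      rewrite F_refl; case: d_am => _ _ /(_ v v)[_ ->]//.
      by rewrite mulr0 adde0.
    have := v_strict x xv.
    have : e v x <= b (Gamma v) * d v x by rewrite eE BE; exact: zhong_le.
    case: (F v x) => [s||] //=.
      by rewrite -EFinD !lee_fin lte_fin; lra.
    by rewrite leey.
- have uD : Dom mu u by exact: (le_lt_trans mu_rho (ltry _)).
  split=> // v [euv eF Fmu].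
  have d_rho : d u v <= rho.
    have : e u v <= B (Gamma u + rho) - B (Gamma u).
      by rewrite -lee_fin (le_trans eF)// (le_trans Fmu).
    rewrite eE /zhong_metric lerD2r BE primitive0_mono ?lerD2l//.
    by rewrite addr_ge0// ltW.
  have bd_F : ((b (Gamma u + rho) * d u v)%:E <= - F u v)%E.
    apply: le_trans eF; rewrite lee_fin (le_trans _ euv)//.
    by rewrite ler_wpM2r// b_ni// lerD2l.
  split=> //; first by have := Gamma_ane u v; lra.
  rewrite -leeN2 oppe0 (le_trans _ bd_F)// lee_fin mulr_ge0// ltW//.
  by rewrite b_gt0// addr_ge0// ltW.
Qed.
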